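(* Consider $n$ system qubits and $n_E$ ancillary qubits. Let $U_i$, $i\in\{0,\dots,2^n-1\}$, be unitaries on the ancillary qubits, and let $C=\sum_{i} U_i\otimes|i\rangle\langle i|$ be the gate on ancillas $\otimes$ system that applies $U_i$ to the ancillas controlled on the system being in $|i\rangle$. For each $\mu\in\{0,\dots,2^{n_E}-1\}$ let $F_\mu$ be a unitary on the $n$ system qubits with phase polynomial representation $(p_\mu,f_\mu)$. Consider the following operation on the system: prepare the ancillas in $|0\rangle$, apply $C$, measure the ancillas in the computational basis with outcome $\mu$, apply $F_\mu$ to the system, and discard the ancillas and $\mu$. That is, for a system density matrix $\rho$, $$\Phi(\rho)=\sum_{\mu}F_\mu\,(\langle\mu|\otimes \mathbf 1)\,C\,(|0\rangle\langle 0|\otimes\rho)\,C^\dagger\,(|\mu\rangle\otimes \mathbf 1)\,F_\mu^\dagger .$$ Put $P(\mu|x)=|\langle\mu|U_x|0\rangle|^2$ and $$M=\sum_{\mu,x}P(\mu|x)\,|f_\mu(x)\rangle\langle x| ,$$ where the sums run over $\mu\in\{0,\dots,2^{n_E}-1\}$ and $x\in\{0,\dots,2^n-1\}$. Then $M$ is a (column-)stochastic matrix and, with $f$ denoting the classical stochastic process on $\{0,\dots,2^n-1\}$ that sends $x$ to $y$ with probability $M_{yx}$: (1) (Post-processing.) For every density matrix $\rho$ on the system, applying $\Phi$ and then measuring the system in the computational basis gives the same outcome distribution as measuring $\rho$ in the computational basis and then applying the stochastic process $f$ to the outcome: for all $y$, $$\langle y|\Phi(\rho)|y\rangle=\sum_x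 M_{yx}\langle x|\rho|x\rangle .$$ (2) (Pre-processing.) For every $x\in\{0,\dots,2^n-1\}$, preparing the system in $|x\rangle$ and applying $\Phi$ yields the same state as preparing the random computational basis state $|f(x)\rangle$: $$\Phi(|x\rangle\langle x|)=\sum_{y}M_{yx}|y\rangle\langle y| .$$
   Context: The Hilbert space of $m$ qubits is $(\mathbb{C}^2)^{\otimes m}$ with computational basis $|0\rangle,\dots,|2^m-1\rangle$; $|0\rangle$ on the ancillas is the computational basis state with all ancillary qubits in $|0\rangle$. A unitary $F$ on $n$ qubits has phase polynomial representation $(p,f)$ if $F|x\rangle=e^{ip(x)}|f(x)\rangle$ for all $x\in\{0,\dots,2^n-1\}$, where $p:\{0,\dots,2^n-1\}\to\mathbb{R}$ is an arbitrary real function (not necessarily a polynomial) and $f:\{0,\dots,2^n-1\}\to\{0,\dots,2^n-1\}$. $M_{yx}=\langle y|M|x\rangle$. Column-stochastic means nonnegative entries with every column summing to $1$. Measuring a density matrix $\rho$ in the computational basis gives outcome $x$ with probability $\langle x|\rho|x\rangle$. *)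

(* Defs.v *)
From mathcomp Require Import all_boot all_order all_algebra.
From mathcomp Require Import reals trigo.
From mathcomp Require Import complex mxtens.

Set Implicit Arguments.
Unset Strict Implicit.
Unset Printing Implicit Defensive.

Import Order.TTheory GRing.Theory Num.Theory.
Local Open Scope ring_scope.
Local Open Scope complex_scope.
Local Open Scope sesquilinear_scope.

(* The space of m qubits is C^(2^m), with C := R[i] for a real type R; the
   computational basis is indexed by 'I_(2 ^ m).  Operators act on column
   vectors, M^t* is the conjugate transpose, and A *t B is the Kronecker
   product, whose left factor carries the most significant qubits. *)

Fact zero_index_subproof (m : nat) : (0 < 2 ^ m)%N.
Proof. by rewrite expn_gt0. Qed.

Definition zero_index (m : nat) : 'I_(2 ^ m) := Ordinal (zero_index_subproof m).

Definition ket (R : realType) (m : nat) (x : 'I_(2 ^ m)) : 'cV[R[i]]_(2 ^ m) :=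
  delta_mx x 0.

Definition bra (R : realType) (m : nat) (x : 'I_(2 ^ m)) : 'rV[R[i]]_(2 ^ m) :=
  (ket R x)^t*.

(* <y|A|x> *)
Definition braket (R : realType) (m : nat) (y : 'I_(2 ^ m))
    (A : 'M[R[i]]_(2 ^ m)) (x : 'I_(2 ^ m)) : R[i] :=
  (bra R y *m A *m ket R x) 0 0.

(* |x><x| *)
Definition proj (R : realType) (m : nat) (x : 'I_(2 ^ m)) : 'M[R[i]]_(2 ^ m) :=
  ket R x *m bra R x.

(* The order of R[i] only compares numbers with the same imaginary part, so
   0 <= z says that z is real and nonnegative. *)
Definition density (R : realType) (m : nat) (rho : 'M[R[i]]_(2 ^ m)) : Prop :=
  [/\ rho^t* = rho,
      forall v : 'cV[R[i]]_(2 ^ m), 0 <= (v^t* *m rho *m v) 0 0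
    & \tr rho = 1].

Definition column_stochastic (R : realType) (m : nat)
    (M : 'M[R[i]]_(2 ^ m)) : Prop :=
  (forall y x, 0 <= M y x) /\ (forall x, \sum_y M y x = 1).

(* e^(it), by Euler's formula *)
Definition expi (R : realType) (t : R) : R[i] := cos t +i* sin t.

Definition phase_poly_rep (R : realType) (n : nat) (F : 'M[R[i]]_(2 ^ n))
    (p : 'I_(2 ^ n) -> R) (f : 'I_(2 ^ n) -> 'I_(2 ^ n)) : Prop :=
  forall x, F *m ket R x = expi (p x) *: ket R (f x).

(* C = sum_i U_i (x) |i><i|, on ancillas (x) system *)
Definition ctrl_gate (R : realType) (n nE : nat)
    (U : 'I_(2 ^ n) -> 'M[R[i]]_(2 ^ nE)) : 'M[R[i]]_(2 ^ nE * 2 ^ n) :=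
  \sum_i (U i *t proj R i).

(* <mu| (x) 1; the cast identifies C (x) C^(2^n) with C^(2^n). *)
Definition anc_bra (R : realType) (n nE : nat) (mu : 'I_(2 ^ nE)) :
    'M[R[i]]_(2 ^ n, 2 ^ nE * 2 ^ n) :=
  castmx (mul1n (2 ^ n)%N, erefl (2 ^ nE * 2 ^ n)%N)
    (bra R mu *t (1%:M : 'M[R[i]]_(2 ^ n))).

Definition Phi (R : realType) (n nE : nat)
    (U : 'I_(2 ^ n) -> 'M[R[i]]_(2 ^ nE))
    (F : 'I_(2 ^ nE) -> 'M[R[i]]_(2 ^ n))
    (rho : 'M[R[i]]_(2 ^ n)) : 'M[R[i]]_(2 ^ n) :=
  \sum_mu (F mu *m anc_bra R n mu *m ctrl_gate U
           *m (proj R (zero_index nE) *t rho)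
           *m (ctrl_gate U)^t* *m (anc_bra R n mu)^t* *m (F mu)^t*).

(* P(mu|x) *)
Definition cond_prob (R : realType) (n nE : nat)
    (U : 'I_(2 ^ n) -> 'M[R[i]]_(2 ^ nE))
    (mu : 'I_(2 ^ nE)) (x : 'I_(2 ^ n)) : R[i] :=
  `|braket mu (U x) (zero_index nE)| ^+ 2.

Definition process_mx (R : realType) (n nE : nat)
    (U : 'I_(2 ^ n) -> 'M[R[i]]_(2 ^ nE))
    (f : 'I_(2 ^ nE) -> 'I_(2 ^ n) -> 'I_(2 ^ n)) : 'M[R[i]]_(2 ^ n) :=
  \sum_mu \sum_x cond_prob U mu x *: (ket R (f mu x) *m bra R x).

(* Main.v *)
Require Import Defs.
From mathcomp Require Import all_boot all_order all_algebra.
From mathcomp Require Import reals trigo.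
From mathcomp Require Import complex mxtens.

Import Order.TTheory GRing.Theory Num.Theory.
Local Open Scope ring_scope.
Local Open Scope complex_scope.
Local Open Scope sesquilinear_scope.

(** Preparing the ancillas in |0>, applying C and obtaining the outcome mu acts
   on the system as the diagonal operator D_mu = sum_x <mu|U_x|0> |x><x|, so
   Phi has the Kraus operators K_mu = F_mu D_mu, and K_mu maps |x> to
   <mu|U_x|0> e^(i p_mu(x)) |f_mu(x)>.  Pre-processing follows from
   |e^(i p)| = 1.  For post-processing, unitarity of F_mu makes f_mu injective,
   so each row of K_mu has at most one nonzero entry and no coherence of rho
   reaches the diagonal of K_mu rho K_mu^*. *)

Lemma adjmxM (C : numClosedFieldType) (m n q : nat)
    (A : 'M[C]_(m, n)) (B : 'M[C]_(n, q)) : (A *m B)^t* = B^t* *m A^t*.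
Proof. by rewrite trmx_mul map_mxM. Qed.

Lemma adjmxE (C : numClosedFieldType) (m n : nat) (A : 'M[C]_(m, n)) i j :
  A^t* i j = (A j i)^*%R.
Proof. by rewrite !mxE. Qed.

Lemma sqr_norm_expi (R : realType) (t : R) : `|expi t| ^+ 2 = 1.
Proof.
rewrite normCK /expi; simpc.
by rewrite -!expr2 cos2Dsin2 [cos t * _]mulrC addNr.
Qed.

Section Entries.
Context {R : realType}.

Lemma ketE (m : nat) (x i : 'I_(2 ^ m)) j : ket R x i j = (i == x)%:R.
Proof. by rewrite mxE ord1 andbT. Qed.

Lemma braE (m : nat) (x i : 'I_(2 ^ m)) j : bra R x j i = (i == x)%:R.
Proof. by rewrite !mxE ord1 andbT rmorph_nat. Qed.

Lemma outerE (m : nat) (x y i j : 'I_(2 ^ m)) :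
  (ket R x *m bra R y) i j = ((i == x) && (j == y))%:R.
Proof. by rewrite mxE big_ord1 ketE braE -natrM mulnb. Qed.

Lemma mulmx_ketE (m q : nat) (A : 'M[R[i]]_(q, 2 ^ m)) (x : 'I_(2 ^ m)) i j :
  (A *m ket R x) i j = A i x.
Proof. by rewrite /ket -colE mxE. Qed.

Lemma mul_bra_mxE (m q : nat) (A : 'M[R[i]]_(2 ^ m, q)) (x : 'I_(2 ^ m)) i j :
  (bra R x *m A) i j = A x j.
Proof.
rewrite mxE (bigD1 x) //= big1 => [|k /negPf kx].
  by rewrite braE eqxx mul1r addr0.
by rewrite braE kx mul0r.
Qed.

Lemma braketE (m : nat) (y x : 'I_(2 ^ m)) (A : 'M[R[i]]_(2 ^ m)) :
  braket y A x = A y x.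
Proof. by rewrite /braket mulmx_ketE mul_bra_mxE. Qed.

Lemma anc_braE (n nE : nat) (mu a : 'I_(2 ^ nE)) (i j : 'I_(2 ^ n)) :
  anc_bra R n mu i (mxtens_index (a, j)) = ((a == mu) && (i == j))%:R.
Proof.
rewrite castmxE /= cast_ord_id.
(* The bra has a single row, so the pair [(0, i)] is encoded as [0 * 2 ^ n + i]: the cast leaves the
   value of [i] unchanged. *)
have -> : cast_ord (esym (mul1n (2 ^ n)%N)) i = mxtens_index (ord0, i).
  by apply: val_inj; rewrite /= mul0n.
by rewrite tensmxE braE mxE -natrM mulnb.
Qed.

Lemma mul_anc_bra_mxE (n nE q : nat) (mu : 'I_(2 ^ nE))
    (A : 'M[R[i]]_(2 ^ nE * 2 ^ n, q)) i j :
  (anc_bra R n mu *m A) i j = A (mxtens_index (mu, i)) j.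
Proof.
rewrite mxE (bigD1 (mxtens_index (mu, i))) //= anc_braE !eqxx mul1r big1 ?addr0 //.
move=> k; case: (mxtens_indexP k) => a l neq.
rewrite anc_braE; have [a_mu|_] := eqVneq a mu; last by rewrite mul0r.
by have [il|_] := eqVneq i l; [rewrite a_mu il eqxx in neq | rewrite andbF mul0r].
Qed.

Lemma mulmx_anc_ketE (n nE q : nat) (mu : 'I_(2 ^ nE))
    (A : 'M[R[i]]_(q, 2 ^ nE * 2 ^ n)) i j :
  (A *m (anc_bra R n mu)^t*) i j = A i (mxtens_index (mu, j)).
Proof.
(* Taking adjoints turns this column selection into the row selection of [mul_anc_bra_mxE]. *)
rewrite -[A in LHS]trmxCK -adjmxM.
by rewrite adjmxE mul_anc_bra_mxE adjmxE conjCK.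
Qed.

Lemma ctrl_gateE (n nE : nat) (U : 'I_(2 ^ n) -> 'M[R[i]]_(2 ^ nE)) a i b j :
  ctrl_gate U (mxtens_index (a, i)) (mxtens_index (b, j)) =
  U i a b * (i == j)%:R.
Proof.
rewrite summxE (bigD1 i) //= big1 => [|k /negPf ki].
  by rewrite tensmxE outerE eqxx addr0 eq_sym.
by rewrite tensmxE outerE eq_sym ki mulr0.
Qed.

(** Preparing an ancilla state is conjugation by the isometry |a> (x) 1. This takes [rho] out of the
    tensor product and puts each summand of [Phi] in Kraus form. *)
Lemma anc_state_tens (n nE : nat) (a : 'I_(2 ^ nE)) (rho : 'M[R[i]]_(2 ^ n)) :
  proj R a *t rho = (anc_bra R n a)^t* *m rho *m anc_bra R n a.
Proof.
apply/matrixP => k l.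
case: (mxtens_indexP k) => b i.
case: (mxtens_indexP l) => c j.
rewrite tensmxE outerE -mulmxA mxE (bigD1 i) //= big1 => [|x /negPf xi].
  rewrite addr0 !mxE anc_braE eqxx andbT rmorph_nat (bigD1 j) //= big1.
    by rewrite anc_braE eqxx andbT addr0 mulrCA mulrC -natrM mulnb andbC.
  by move=> y /negPf yj; rewrite anc_braE yj andbF mulr0.
by rewrite !mxE anc_braE xi andbF rmorph_nat mul0r.
Qed.

End Entries.

Section Process.
Context {R : realType} {n nE : nat}.
Context {U : 'I_(2 ^ n) -> 'M[R[i]]_(2 ^ nE)}.
Context {F : 'I_(2 ^ nE) -> 'M[R[i]]_(2 ^ n)}.
Context {p : 'I_(2 ^ nE) -> 'I_(2 ^ n) -> R}.
Context {f : 'I_(2 ^ nE) -> 'I_(2 ^ n) -> 'I_(2 ^ n)}.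

Definition kraus (mu : 'I_(2 ^ nE)) : 'M[R[i]]_(2 ^ n) :=
  F mu *m anc_bra R n mu *m ctrl_gate U *m (anc_bra R n (zero_index nE))^t*.

Lemma Phi_kraus (rho : 'M[R[i]]_(2 ^ n)) :
  Phi U F rho = \sum_mu kraus mu *m rho *m (kraus mu)^t*.
Proof.
apply: eq_bigr => mu _.
by rewrite anc_state_tens /kraus !adjmxM trmxCK !mulmxA.
Qed.

Lemma process_mxE y x :
  process_mx U f y x = \sum_mu cond_prob U mu x * (y == f mu x)%:R.
Proof.
rewrite summxE; apply: eq_bigr => mu _; rewrite summxE (bigD1 x) //= big1.
  by rewrite addr0 mxE outerE eqxx andbT.
by move=> z /negPf zx; rewrite mxE outerE (eq_sym x) zx andbF mulr0.
Qed.

Lemma process_mx_stochastic :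
  (forall x, U x \is unitarymx) -> column_stochastic (process_mx U f).
Proof.
move=> unitary_U; split=> [y x|x].
  rewrite process_mxE; apply: sumr_ge0 => mu _.
  by rewrite mulr_ge0 ?ler0n // exprn_ge0.
under eq_bigr do rewrite process_mxE.
rewrite exchange_big /=.
transitivity (\sum_mu cond_prob U mu x).
  apply: eq_bigr => mu _; rewrite -mulr_sumr (bigD1 (f mu x)) //= eqxx.
  by rewrite big1 ?addr0 ?mulr1 // => y /negPf ->.
(* The probabilities P(mu|x) are the squared moduli of column 0 of U_x, and their sum is the (0,0)
   entry of U_x^* U_x = 1. *)
have /unitarymxP/mulmx1C/matrixP/(_ (zero_index nE) (zero_index nE)) :=
  unitary_U x.
rewrite !mxE eqxx mulr1n => <-; apply: eq_bigr => mu _.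
by rewrite /cond_prob braketE normCK !mxE mulrC.
Qed.

Context (rep_F : forall mu, phase_poly_rep (F mu) (p mu) (f mu)).

Lemma phase_poly_repE mu y x : F mu y x = expi (p mu x) * (y == f mu x)%:R.
Proof. by rewrite -(mulmx_ketE _ _ (F mu) x y ord0) rep_F mxE ketE. Qed.

Lemma krausE mu y x :
  kraus mu y x =
  expi (p mu x) * U x mu (zero_index nE) * (y == f mu x)%:R.
Proof.
(* C is block diagonal in the system index, so only the intermediate state [x] contributes. *)
rewrite /kraus mulmx_anc_ketE -!mulmxA mxE (bigD1 x) //= big1 => [|z /negPf zx].
  by rewrite addr0 mul_anc_bra_mxE ctrl_gateE eqxx mulr1 phase_poly_repE mulrAC.
by rewrite mul_anc_bra_mxE ctrl_gateE zx !mulr0.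
Qed.

(** The phase has modulus 1 and the indicator is its own square. Summed over [mu], these are the
    entries of [process_mx], which links [Phi] to the classical process. *)
Lemma sqr_norm_krausE mu y x :
  kraus mu y x * (kraus mu y x)^*%R = cond_prob U mu x * (y == f mu x)%:R.
Proof.
rewrite -normCK krausE !normrM !exprMn sqr_norm_expi mul1r /cond_prob braketE.
by rewrite normr_nat -natrX; case: (y == _).
Qed.

(** Distinct columns of a unitary are orthogonal. If f_mu sent [x] and [x'] to the same state, the
    inner product of these columns would be a product of two phases, hence nonzero. *)
Lemma phase_poly_rep_inj mu : F mu \is unitarymx -> injective (f mu).
Proof.
move=> /unitarymxP/mulmx1C FF x x' fxx'; apply/eqP; apply/negPn/negP => xx'.
have /eqP := congr1 (fun A : 'M_(2 ^ n) => A x x') FF.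
rewrite [_ x x']mxE (bigD1 (f mu x)) //= big1 => [|y /negPf yf].
  rewrite addr0 !mxE !phase_poly_repE -fxx' eqxx !mulr1 (negPf xx').
  have expi_neq0 t : expi t != 0 :> R[i].
    by rewrite -normr_eq0 -sqrf_eq0 sqr_norm_expi oner_eq0.
  by rewrite mulf_eq0 conjC_eq0 !(negPf (expi_neq0 _)).
by rewrite !phase_poly_repE -fxx' yf !mulr0.
Qed.

Lemma Phi_post_processing (rho : 'M[R[i]]_(2 ^ n)) y :
  (forall mu, F mu \is unitarymx) ->
  braket y (Phi U F rho) y = \sum_x process_mx U f y x * braket x rho x.
Proof.
move=> unitary_F; rewrite braketE Phi_kraus summxE.
under [RHS]eq_bigr do rewrite process_mxE braketE mulr_suml.
rewrite exchange_big; apply: eq_bigr => mu _ /=.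
rewrite mxE; apply: eq_bigr => x _; rewrite mxE mulr_suml (bigD1 x) //= big1.
  by rewrite addr0 -sqr_norm_krausE adjmxE mulrAC.
(* A coherence [rho z x] enters with the factor K_yz conj(K_yx), which is nonzero only if f_mu(z) =
   y = f_mu(x); injectivity excludes this for [z != x]. *)
move=> z zx; rewrite adjmxE !krausE.
have [->|] := eqVneq y (f mu x); last by rewrite mulr0 conjC0 mulr0.
rewrite (inj_eq (phase_poly_rep_inj mu (unitary_F mu))) eq_sym (negPf zx).
by rewrite mulr0 !mul0r.
Qed.

Lemma Phi_pre_processing x :
  Phi U F (proj R x) = \sum_y process_mx U f y x *: proj R y.
Proof.
rewrite Phi_kraus; apply/matrixP => y z.
have -> : (\sum_w process_mx U f w x *: proj R w) y z =
    process_mx U f y x * (y == z)%:R.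
  rewrite summxE (bigD1 y) //= big1 => [|w /negPf wy].
    by rewrite addr0 mxE outerE eqxx eq_sym.
  by rewrite mxE outerE eq_sym wy mulr0.
rewrite summxE process_mxE mulr_suml; apply: eq_bigr => mu _.
(* K|x><x|K^* is the outer product of K|x> with itself, so its (y,z) entry is K_yx conj(K_zx). Off
   the diagonal one factor vanishes, since K|x> is a multiple of a single ket. *)
rewrite -sqr_norm_krausE /proj !mulmxA -mulmxA -adjmxM mxE big_ord1.
rewrite mulmx_ketE adjmxE mulmx_ketE.
have [->|yz] := eqVneq y z; first by rewrite mulr1.
rewrite mulr0 !krausE; have [yf|_] := eqVneq y (f mu x).
  by rewrite -yf eq_sym (negPf yz) mulr0 conjC0 mulr0.
by rewrite mulr0 mul0r.
Qed.

End Process.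

Theorem mainTheorem3 (R : realType) (n nE : nat)
    (U : 'I_(2 ^ n) -> 'M[R[i]]_(2 ^ nE))
    (F : 'I_(2 ^ nE) -> 'M[R[i]]_(2 ^ n))
    (p : 'I_(2 ^ nE) -> 'I_(2 ^ n) -> R)
    (f : 'I_(2 ^ nE) -> 'I_(2 ^ n) -> 'I_(2 ^ n))
    (unitary_U : forall i, U i \is unitarymx)
    (unitary_F : forall mu, F mu \is unitarymx)
    (rep_F : forall mu, phase_poly_rep (F mu) (p mu) (f mu)) :
  let M := process_mx U f in
  [/\ column_stochastic M,
      forall rho : 'M[R[i]]_(2 ^ n), density rho ->
        forall y, braket y (Phi U F rho) y = \sum_x M y x * braket x rho x
    & forall x, Phi U F (proj R x) = \sum_y M y x *: proj R y].
Proof.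
split.
- exact: process_mx_stochastic.
- by move=> rho _ y; exact: (Phi_post_processing rep_F).
- exact: (Phi_pre_processing rep_F).
Qed.
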